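(* Let $r\in\mathbb{N}$. Let $\tau^s$ be the optimal value of the separation problem $\mathcal{P}^s$, and let $\tau^s_r(\boldsymbol{y}^1,\boldsymbol{y}^2)$ be the optimal value of the moment relaxation $\mathcal{P}^s_r(\boldsymbol{y}^1,\boldsymbol{y}^2)$, where $\boldsymbol{y}^i$ is the moment sequence of the probability measure $\mu^i=\sum_{\boldsymbol{x}\in S_i}\mu^i_{\boldsymbol{x}}\delta_{\boldsymbol{x}}$ on $S_i$, $i=1,2$. Assume that, for $i=1,2$, $|S_i|=\binom{n+r}{r}$, $S_i$ is $r$-generic, and $\mu^i_{\boldsymbol{x}}>0$ for all $\boldsymbol{x}\in S_i$. Then $$|S_i|=\operatorname{rank}\bigl(M_r(\boldsymbol{y}^i)\bigr)\quad (i=1,2)\qquad\text{and}\qquad \tau^s_r(\boldsymbol{y}^1,\boldsymbol{y}^2)=\tau^s.$$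
   Context: Let $n\ge1$, $d\in\mathbb{N}$, $t=\binom{n+d}{d}$. For $\boldsymbol\gamma\in\mathbb{N}^n$ put $|\boldsymbol\gamma|=\gamma_1+\dots+\gamma_n$ and $\boldsymbol{x}^{\boldsymbol\gamma}=x_1^{\gamma_1}\cdots x_n^{\gamma_n}$. A polynomial $\theta(\boldsymbol{x})=\sum_{|\boldsymbol\gamma|\le d}\theta_{\boldsymbol\gamma}\boldsymbol{x}^{\boldsymbol\gamma}\in\mathbb{R}[\boldsymbol{x}]$ of degree at most $d$ is identified with its coefficient vector $\boldsymbol\theta=(\theta_{\boldsymbol\gamma})_{|\boldsymbol\gamma|\le d}\in\mathbb{R}^t$ (with $\theta_{\boldsymbol\gamma}=0$ for $|\boldsymbol\gamma|>d$). Let $\Theta\subset\mathbb{R}^t$, let $f:\Theta\to\mathbb{R}$ be an objective function, and let $S_1,S_2\subset\mathbb{R}^n$ be finite sets. Separation problem $\mathcal{P}^s$: $\tau^s=\inf\{f(\boldsymbol\theta):\ \boldsymbol\theta\in\Theta,\ \theta(\boldsymbol{x})\ge0\ \forall\boldsymbol{x}\in S_1,\ -\theta(\boldsymbol{x})\ge0\ \forall\boldsymbol{x}\in S_2\}$. Genericity: a finite set $S\subset\mathbb{R}^n$ is $r$-generic if it is not contained in the level set $\{\boldsymbol{x}:g(\boldsymbol{x})=0\}$ of any nonzero polynomial $g$ of degree at most $r$. Measures and moments: for $i=1,2$, $\mu^i=\sum_{\boldsymbol{x}\in S_i}\mu^i_{\boldsymbol{x}}\delta_{\boldsymbol{x}}$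 is a probability measure on $S_i$ ($\mu^i_{\boldsymbol{x}}\ge0$, $\sum_{\boldsymbol{x}\in S_i}\mu^i_{\boldsymbol{x}}=1$), with moments $y^i_{\boldsymbol\alpha}=\sum_{\boldsymbol{x}\in S_i}\mu^i_{\boldsymbol{x}}\boldsymbol{x}^{\boldsymbol\alpha}$, $\boldsymbol\alpha\in\mathbb{N}^n$, and $\boldsymbol{y}^i=(y^i_{\boldsymbol\alpha})_{\boldsymbol\alpha}$. Moment and localizing matrices: for $r\in\mathbb{N}$, the $\binom{n+r}{r}\times\binom{n+r}{r}$ matrices indexed by $\boldsymbol\alpha,\boldsymbol\beta\in\mathbb{N}^n$ with $|\boldsymbol\alpha|,|\boldsymbol\beta|\le r$ and entries $M_r(\boldsymbol{y}^i)(\boldsymbol\alpha,\boldsymbol\beta)=y^i_{\boldsymbol\alpha+\boldsymbol\beta}$ and $M_r(\boldsymbol\theta\boldsymbol{y}^i)(\boldsymbol\alpha,\boldsymbol\beta)=\sum_{\boldsymbol\gamma}\theta_{\boldsymbol\gamma}\,y^i_{\boldsymbol\alpha+\boldsymbol\beta+\boldsymbol\gamma}$. Moment relaxation $\mathcal{P}^s_r(\boldsymbol{y}^1,\boldsymbol{y}^2)$: $\tau^s_r(\boldsymbol{y}^1,\boldsymbol{y}^2)=\inf\{f(\boldsymbol\theta):\ \boldsymbol\theta\in\Theta,\ M_r(\boldsymbol\theta\boldsymbol{y}^1)\succeq0,\ M_r(-\boldsymbol\theta\boldsymbol{y}^2)\succeq0\}$, where $\succeq0$ means positive semidefinite. Infima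 are taken in $[-\infty,+\infty]$, with $\inf\emptyset=+\infty$. *)

(* Defs.v *)
(* [mpoly] must be imported before the analysis files: in the other order the
   level-2 notations of the two libraries clash. *)
From HB Require Import structures.
From mathcomp Require Import all_boot all_order all_algebra.
From mathcomp Require Import finmap.
From mathcomp Require Import mpoly.
From mathcomp Require Import classical_sets reals ereal.
Set Implicit Arguments.
Unset Strict Implicit.
Unset Printing Implicit Defensive.
Import Order.TTheory GRing.Theory Num.Theory.
Local Open Scope ring_scope.
Local Open Scope classical_set_scope.

(* ['X_{1..n < d.+1}] is the type of exponents gamma with |gamma| <= d, so this
   is R^t with t = 'C(n + d, d), coordinates being indexed by monomials.  The
   coefficients of degree > d are implicitly zero. *)
Definition coefs (R : realType) (n d : nat) := {ffun 'X_{1..n < d.+1} -> R}.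

Definition poly_of (R : realType) (n d : nat) (theta : coefs R n d) :
    {mpoly R[n]} :=
  \sum_(g : 'X_{1..n < d.+1}) theta g *: 'X_[g].

Definition peval (R : realType) (n : nat) (p : {mpoly R[n]}) (x : 'rV[R]_n) : R :=
  p.@[x 0].

(* [msize] is the degree plus one on nonzero polynomials. *)
Definition generic (R : realType) (n r : nat) (S : {fset 'rV[R]_n}) : Prop :=
  ~ exists g : {mpoly R[n]},
      [/\ g != 0, (msize g <= r.+1)%N & forall x, x \in S -> peval g x = 0].

(* A measure \sum_(x in S) mu x * delta_x is given by its weights; the values of
   [mu] outside S are irrelevant. *)
Definition prob_on (R : realType) (n : nat) (S : {fset 'rV[R]_n})
    (mu : 'rV[R]_n -> R) : Prop :=
  (forall x, x \in S -> 0 <= mu x) /\ \sum_(x <- S) mu x = 1.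

Definition moment (R : realType) (n : nat) (S : {fset 'rV[R]_n})
    (mu : 'rV[R]_n -> R) (a : 'X_{1..n}) : R :=
  \sum_(x <- S) mu x * \prod_(i < n) x 0 i ^+ a i.

(* Rows and columns are the exponents of degree <= r, in the order of their
   enumeration. *)
Definition moment_mx (R : realType) (n r : nat) (y : 'X_{1..n} -> R) :
    'M[R]_#|{: 'X_{1..n < r.+1}}| :=
  \matrix_(i, j) y (bmnm (enum_val i) + bmnm (enum_val j))%MM.

Definition shift (R : realType) (n d : nat) (theta : coefs R n d)
    (y : 'X_{1..n} -> R) (a : 'X_{1..n}) : R :=
  \sum_(g : 'X_{1..n < d.+1}) theta g * y (a + g)%MM.

Definition localizing_mx (R : realType) (n d r : nat) (theta : coefs R n d)
    (y : 'X_{1..n} -> R) : 'M[R]_#|{: 'X_{1..n < r.+1}}| :=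
  moment_mx r (shift theta y).

Definition psd (R : realType) (N : nat) (A : 'M[R]_N) : Prop :=
  A^T = A /\ forall v : 'cV[R]_N, 0 <= (v^T *m A *m v) 0 0.

(* In the next two definitions [Theta] as a type is the subtype of its elements,
   and f is only defined there. *)
Definition tau_sep (R : realType) (n d : nat) (Theta : set (coefs R n d))
    (f : Theta -> R) (S1 S2 : {fset 'rV[R]_n}) : \bar R :=
  ereal_inf [set (f theta)%:E | theta in [set theta : Theta |
    (forall x, x \in S1 -> 0 <= peval (poly_of (val theta)) x) /\
    (forall x, x \in S2 -> 0 <= - peval (poly_of (val theta)) x)]].

Definition tau_relax (R : realType) (n d : nat) (Theta : set (coefs R n d))
    (f : Theta -> R) (r : nat) (y1 y2 : 'X_{1..n} -> R) : \bar R :=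
  ereal_inf [set (f theta)%:E | theta in [set theta : Theta |
    psd (localizing_mx r (val theta) y1) /\
    psd (localizing_mx r (- val theta) y2)]].

(* Main.v *)
Require Import Defs.
From HB Require Import structures.
From mathcomp Require Import all_boot all_order all_algebra.
From mathcomp Require Import finmap.
From mathcomp Require Import mpoly.
From mathcomp Require Import classical_sets reals ereal.
Set Implicit Arguments.
Unset Strict Implicit.
Unset Printing Implicit Defensive.
Import Order.TTheory GRing.Theory Num.Theory.
Local Open Scope ring_scope.
Local Open Scope classical_set_scope.

(** Evaluate the monomials of degree at most [r] at the points of [S]: this gives
    a Vandermonde matrix [V], with one row per point and one column per
    monomial.  For weights [w] on [S], the moment matrix of
    [\sum_(x in S) w x * delta_x] factors as [V^T * D * V], where [D] is the
    diagonal matrix of the weights ([moment_mxE]).  A vector in the kernel of [V]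
    is the coefficient vector of a polynomial of degree at most [r] vanishing on
    [S], so genericity says that the columns of [V] are independent.  There are
    ['C(n + r, r)] of them ([card_bmultinom]), as many as there are points, so
    [V] is square and invertible ([vdm_row_free]).  The moment matrix is thus
    congruent to [D]: its rank is the number of points when the weights do not
    vanish, and it is positive semidefinite exactly when the weights are
    nonnegative ([rank_moment_mx], [psd_moment_mx]).

    The localizing matrix of [theta] and [mu] is the moment matrix of the weights
    [mu x * theta x] ([localizing_mx_moment]).  As [mu] is positive on [S], it is
    positive semidefinite exactly when [theta] is nonnegative on [S].  Hence the
    relaxation and the separation problem have the same feasible set, and so the
    same value. *)

(** An exponent of degree at most [r] in [n] variables is an [n]-tuple of
    elements of ['I_r.+1] with sum at most [r]; those tuples are counted by
    [card_partial_ord_partitions]. *)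
Lemma card_bmultinom (n r : nat) : #|{: 'X_{1..n < r.+1}}| = 'C(n + r, r).
Proof.
pose g (a : 'X_{1..n < r.+1}) : n.-tuple 'I_r.+1 :=
  [tuple inord (bmnm a i) | i < n].
have le_ar (a : 'X_{1..n < r.+1}) i : (bmnm a i < r.+1)%N.
  apply: leq_ltn_trans (bmdeg a); rewrite mdegE.
  by rewrite (bigD1 i) //= leq_addr.
have gE a i : tnth (g a) i = bmnm a i :> nat.
  by rewrite tnth_mktuple inordK.
have g_inj : injective g.
  move=> a b /(congr1 (fun t i => tnth t i)) eq_g.
  apply/val_inj/mnmP => i; rewrite -!gE.
  by congr (nat_of_ord _); exact: (congr1 (@^~ i) eq_g).
rewrite -bin_sub ?leq_addl // addnK.
rewrite -card_partial_ord_partitions -cardsT -(card_imset _ g_inj).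
apply: eq_card => t; rewrite inE; apply/imsetP/idP => [[a _ ->]|le_t].
  rewrite big_tuple; under eq_bigr do rewrite gE.
  by rewrite -mdegE -ltnS bmdeg.
have lt_t : (mdeg [multinom nat_of_ord (tnth t i) | i < n] < r.+1)%N.
  rewrite ltnS mdegE; under eq_bigr do rewrite mnmE.
  by rewrite -(big_tuple _ _ t xpredT (@nat_of_ord _)).
exists (BMultinom lt_t) => //; apply: eq_from_tnth => i.
by apply/val_inj; rewrite /= gE mnmE.
Qed.

Section Vandermonde.
Variables (R : realType) (n r : nat) (S : {fset 'rV[R]_n}).
Implicit Types (w : 'rV[R]_n -> R) (x : 'rV[R]_n).

Let pt (k : 'I_#|` S|) : 'rV[R]_n := tnth (in_tuple (enum_fset S)) k.

Let pt_in k : pt k \in S.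
Proof. exact: mem_tnth. Qed.

Let ptP x : x \in S -> exists k, x = pt k.
Proof. by move=> /(@tnthP _ _ (in_tuple (enum_fset S))). Qed.

Definition vdm : 'M[R]_(#|` S|, #|{: 'X_{1..n < r.+1}}|) :=
  \matrix_(k, j) \prod_(i < n) pt k 0 i ^+ bmnm (enum_val j) i.

Definition weight_mx w : 'M[R]_#|` S| := diag_mx (\row_k w (pt k)).

Lemma moment_mxE w :
  moment_mx r (moment S w) = vdm^T *m weight_mx w *m vdm.
Proof.
apply/matrixP => i j; rewrite /weight_mx mul_mx_diag !mxE /moment big_tnth.
apply: eq_bigr => k _; rewrite !mxE -/(pt k) mulrAC [RHS]mulrC; congr (_ * _).
by rewrite -big_split; apply: eq_bigr => l _; rewrite mnmDE exprD.
Qed.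

(** Genericity makes the columns independent; having as many points as monomials
    then makes the rows independent too, so that interpolation by polynomials of
    degree at most [r] is possible on [S]. *)
Lemma vdm_row_free :
  #|` S| = 'C(n + r, r) -> generic r S -> row_free vdm.
Proof.
move=> cardS genS; have free_tr : row_free vdm^T.
  apply: inj_row_free => v v0; apply/eqP/contraT => v_neq0; case: genS.
  pose theta : coefs R n r := [ffun a => v 0 (enum_rank a)].
  exists (poly_of theta); split.
  - apply: contra_neq v_neq0 => theta0; apply/rowP => j; rewrite mxE.
    have /(congr1 (mcoeff (bmnm (enum_val j)))) := theta0.
    rewrite mcoeff0 raddf_sum (bigD1 (enum_val j)) //= big1 => [|a neq_aj].
      by rewrite mcoeffZ mcoeffX eqxx mulr1 addr0 ffunE enum_valK.
    by rewrite mcoeffZ mcoeffX (inj_eq val_inj) (negPf neq_aj) mulr0.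
  - apply: leq_trans (msize_sum _ _ _) _; apply/bigmax_leqP => a _.
    by apply: leq_trans (msizeZ_le _ _) _; rewrite msizeX bmdeg.
  - move=> x /ptP[k ->]; have /matrixP/(_ 0 k) := v0; rewrite !mxE => <-.
    rewrite /peval raddf_sum (reindex _ (onW_bij _ (enum_val_bij _))) /=.
    apply: eq_bigr => j _.
    by rewrite mevalZ mevalX ffunE enum_valK !mxE.
by rewrite /row_free -mxrank_tr (eqP free_tr) card_bmultinom -cardS.
Qed.

Hypothesis vdm_free : row_free vdm.

Lemma rank_moment_mx w :
  (forall x, x \in S -> w x != 0) -> \rank (moment_mx r (moment S w)) = #|` S|.
Proof.
move=> w_neq0; rewrite moment_mxE mxrankMfree //.
rewrite -mxrank_tr trmx_mul trmxK mxrankMfree // mxrank_tr.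
apply: mxrank_unit; rewrite unitmxE det_diag unitfE.
by apply/prodf_neq0 => k _; rewrite mxE w_neq0.
Qed.

Lemma moment_formE w (v : 'cV[R]_#|{: 'X_{1..n < r.+1}}|) :
  (v^T *m moment_mx r (moment S w) *m v) 0 0 =
  \sum_k w (pt k) * (vdm *m v) k 0 ^+ 2.
Proof.
rewrite moment_mxE.
have -> : v^T *m (vdm^T *m weight_mx w *m vdm) *m v =
    (vdm *m v)^T *m weight_mx w *m (vdm *m v) by rewrite trmx_mul !mulmxA.
rewrite /weight_mx mul_mx_diag mxE; apply: eq_bigr => k _.
by rewrite [in LHS]mxE [in LHS]mxE [X in _ * X * _]mxE mulrAC mulrC expr2.
Qed.

(** A right inverse of [vdm] yields a polynomial equal to [1] at a given point
    and to [0] at the others; the quadratic form of the moment matrix takes the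
    weight of that point as its value there. *)
Lemma psd_moment_mx w :
  psd (moment_mx r (moment S w)) <-> forall x, x \in S -> 0 <= w x.
Proof.
split=> [[_ ge0] x /ptP[k ->]|w_ge0].
  have [B VB] := row_freeP vdm_free.
  have := ge0 (B *m delta_mx k 0); rewrite moment_formE mulmxA VB mul1mx.
  rewrite (bigD1 k) //= big1 => [|l neq_lk].
    by rewrite mxE !eqxx expr1n mulr1 addr0.
  by rewrite mxE (negPf neq_lk) expr0n mulr0.
split=> [|v]; first by rewrite moment_mxE !trmx_mul trmxK tr_diag_mx mulmxA.
rewrite moment_formE sumr_ge0 // => k _.
by rewrite mulr_ge0 ?sqr_ge0 ?w_ge0.
Qed.

End Vandermonde.

Lemma pevalE (R : realType) (n d : nat) (theta : coefs R n d) (x : 'rV[R]_n) :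
  peval (poly_of theta) x =
  \sum_(g : 'X_{1..n < d.+1}) theta g * \prod_(i < n) x 0 i ^+ bmnm g i.
Proof.
by rewrite /peval raddf_sum; apply: eq_bigr => g _ /=; rewrite mevalZ mevalX.
Qed.

Lemma pevalN (R : realType) (n d : nat) (theta : coefs R n d) (x : 'rV[R]_n) :
  peval (poly_of (- theta)) x = - peval (poly_of theta) x.
Proof.
by rewrite !pevalE -sumrN; apply: eq_bigr => g _; rewrite ffunE mulNr.
Qed.

Lemma localizing_mx_moment (R : realType) (n d r : nat) (theta : coefs R n d)
    (S : {fset 'rV[R]_n}) (mu : 'rV[R]_n -> R) :
  localizing_mx r theta (moment S mu) =
  moment_mx r (moment S (fun x => mu x * peval (poly_of theta) x)).
Proof.
apply/matrixP => i j; rewrite !mxE /shift /moment.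
under eq_bigr do rewrite mulr_sumr.
rewrite exchange_big; apply: eq_bigr => x _ /=.
rewrite pevalE mulrAC mulr_sumr; apply: eq_bigr => g _.
rewrite mulrCA -mulrA; congr (_ * _).
rewrite [RHS]mulrCA; congr (_ * _).
by rewrite -big_split; apply: eq_bigr => l _; rewrite mnmDE exprD.
Qed.

Lemma psd_localizing_mx (R : realType) (n d r : nat) (theta : coefs R n d)
    (S : {fset 'rV[R]_n}) (mu : 'rV[R]_n -> R) :
  row_free (vdm r S) -> (forall x, x \in S -> 0 < mu x) ->
  psd (localizing_mx r theta (moment S mu)) <->
  forall x, x \in S -> 0 <= peval (poly_of theta) x.
Proof.
move=> freeS mu_gt0; rewrite localizing_mx_moment.
apply: (iff_trans (psd_moment_mx freeS _)).
by split=> ge0 x xS; have := ge0 x xS; rewrite pmulr_rge0 ?mu_gt0.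
Qed.

Theorem proposition2 (R : realType) (n d r : nat) (n_ge1 : (1 <= n)%N)
    (Theta : set (coefs R n d)) (f : Theta -> R)
    (S1 S2 : {fset 'rV[R]_n}) (mu1 mu2 : 'rV[R]_n -> R)
    (prob1 : prob_on S1 mu1) (prob2 : prob_on S2 mu2)
    (card1 : #|` S1| = 'C(n + r, r)) (card2 : #|` S2| = 'C(n + r, r))
    (gen1 : generic r S1) (gen2 : generic r S2)
    (mu1_gt0 : forall x, x \in S1 -> 0 < mu1 x)
    (mu2_gt0 : forall x, x \in S2 -> 0 < mu2 x) :
  [/\ #|` S1| = \rank (moment_mx r (moment S1 mu1)),
      #|` S2| = \rank (moment_mx r (moment S2 mu2)) &
      tau_relax f r (moment S1 mu1) (moment S2 mu2) = tau_sep f S1 S2].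
Proof.
have free1 := vdm_row_free card1 gen1; have free2 := vdm_row_free card2 gen2.
split.
- by rewrite rank_moment_mx // => x /mu1_gt0/lt0r_neq0.
- by rewrite rank_moment_mx // => x /mu2_gt0/lt0r_neq0.
congr (ereal_inf (image _ _)); apply/seteqP.
have sep1 (theta : coefs R n d) := psd_localizing_mx theta free1 mu1_gt0.
have sep2 (theta : coefs R n d) := psd_localizing_mx theta free2 mu2_gt0.
split=> theta [/sep1 ? ge2]; split=> //.
  by move=> x xS; rewrite -pevalN; move/sep2: ge2; exact.
by apply/sep2 => x /ge2; rewrite pevalN.
Qed.
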